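(* Let $(X,\mathcal{E})$ be a coarse space ($X$ non-empty), let $\mathcal{I}$ be an upward directed set with a zero, and let $\mathbf{d}_X$ be a coarse $\mathcal{I}$-metric on $X$ defining $\mathcal{E}$ (i.e. $\mathcal{E}=\mathcal{E}_{\mathbf{d}_X}$). The following statements are equivalent. (B1) $(X,\mathcal{E})$ has bounded geometry. (B2) There is $\alpha_1\in\mathcal{I}$ such that for any $\alpha\in\mathcal{I}$ there exists $n_1\in\mathbb{N}$ such that each ball of radius $\alpha$ contains at most $n_1$ points with their pairwise $\mathbf{d}_X$-distances not dominated by $\alpha_1$ (i.e. $\mathbf{d}_X(x,y)\nleq\alpha_1$ for distinct members $x,y$ of the family of points). (B3) There is $\alpha_2\in\mathcal{I}$ such that for any $\alpha\in\mathcal{I}$ there exists $n_2\in\mathbb{N}$ such that for each $x\in X$ the ball $\mathbf{D}(x,\alpha)$ contains at most $n_2$ (pairwise) disjoint relative balls of radius $\alpha_2$, where relative balls of radius $\alpha_2$ are subsets of the form $\mathbf{D}(x,\alpha)\cap\mathbf{D}(y,\alpha_2)$ for some $y\in\mathbf{D}(x,\alpha)$. (B4) There is $\alpha_3\in\mathcal{I}$ such that for any $\alpha\in\mathcal{I}$ there exists $n_3\in\mathbb{N}$ such that each ball of radius $\alpha$ is contained in the union of $n_3$ balls of radius $\alpha_3$.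
   Context: $\mathcal{P}_0(X\times X)$ is the collection of non-empty subsets of $X\times X$; $\Delta_X=\{(x,x):x\in X\}$; for $A,B\subseteq X\times X$: $A^{-1}=\{(y,x):(x,y)\in A\}$, $A\circ B=\{(x,z):\exists y\in X,\ (x,y)\in A,\ (y,z)\in B\}$, and $B[x]=\{y:(x,y)\in B\}$. A coarse structure on $X$ is a collection $\mathcal{E}\subseteq\mathcal{P}_0(X\times X)$ with $\Delta_X\in\mathcal{E}$ that is closed under the formation of (non-empty) subsets, inverses, products $\circ$ (whenever non-empty) and finite unions; $(X,\mathcal{E})$ is then a coarse space. A subcollection $\mathcal{B}\subseteq\mathcal{E}$ is a base for $\mathcal{E}$ if every element of $\mathcal{E}$ is contained in an element of $\mathcal{B}$. A partially ordered set $\mathcal{I}$ is upward directed if any two elements have an upper bound in it; its zero is its smallest element $0_{\mathcal{I}}$. $\mathcal{I}_\infty$ is $\mathcal{I}$ with a new element $\infty$ adjoined that is strictly larger than all elements of $\mathcal{I}$. For $\mathbf{d}:X\times X\to\mathcal{I}_\infty$ and $\alpha\in\mathcal{I}$ put $\mathbf{D}_\alpha=\{(x,y):\mathbf{d}(x,y)\le\alpha\}$; $\mathbf{D}(z,\alpha)=\mathbf{D}_\alpha[z]$ is the ball of radius $\alpha$ with center $z\in X$. $\mathbf{d}$ is a coarse $\mathcal{I}$-metric if $\mathbf{d}(x,x)=0_{\mathcal{I}}$, $\mathbf{d}(x,y)=\mathbf{d}(y,x)$ for all $x,y$, and there is $\Phi:\mathcal{I}\to\mathcal{I}$ with $\mathbf{D}_\alpha\circ\mathbf{D}_\alpha\subseteq\mathbf{D}_{\Phi(\alpha)}$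 for all $\alpha\in\mathcal{I}$. $\mathcal{E}_{\mathbf{d}}$ is the coarse structure having $\{\mathbf{D}_\alpha:\alpha\in\mathcal{I}\}$ as a base. $(X,\mathcal{E})$ has bounded geometry if one can find $E\in\mathcal{E}$ with $\Delta_X\subseteq E$ and $E^{-1}=E$ such that $\sup_{x\in X}\max\{\mathrm{cap}_E((F\circ E)[x]),\mathrm{cap}_E((F^{-1}\circ E)[x])\}<\infty$ for all $F\in\mathcal{E}$, where $\mathrm{cap}_E(S)=\sup\{m\in\mathbb{N}:\text{there exist }y_1,\dots,y_m\in S\text{ with }(y_i,y_j)\notin E\text{ when }i\ne j\}$. *)

(* Defs.v *)
From HB Require Import structures.
From mathcomp Require Import all_boot all_order.
From mathcomp Require Import boolp classical_sets functions cardinality.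

Set Implicit Arguments.
Unset Strict Implicit.
Unset Printing Implicit Defensive.

Import Order.TTheory.
Local Open Scope order_scope.
Local Open Scope classical_set_scope.

(* [with_infty T] is T_oo; it is used both for the values of a coarse metric
   (T = I) and for capacities (T = nat). *)
Definition with_infty (T : Type) : Type := option T.
Definition Fin {T : Type} (a : T) : with_infty T := Some a.
Definition infty {T : Type} : with_infty T := None.

HB.instance Definition _ (T : choiceType) := Choice.on (with_infty T).

Section WithInftyOrder.
Variables (disp : Order.disp_t) (T : porderType disp).

Definition with_infty_le (u v : with_infty T) : bool :=
  match u, v with
  | _, None => true
  | None, Some _ => false
  | Some a, Some b => a <= b
  end.

Lemma with_infty_le_refl : reflexive with_infty_le.
Proof. by case=> /=. Qed.

Lemma with_infty_le_anti : antisymmetric with_infty_le.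
Proof. by move=> [a|] [b|] //= /le_anti ->. Qed.

Lemma with_infty_le_trans : transitive with_infty_le.
Proof. by move=> [b|] [a|] [c|] //=; apply: le_trans. Qed.

HB.instance Definition _ := Order.Le_isPOrder.Build disp (with_infty T)
  with_infty_le_refl with_infty_le_anti with_infty_le_trans.

End WithInftyOrder.

(* The library composition [B \; A] applies A first, so the operands are
   swapped: (x, z) \in relprod A B iff (x, y) \in A and (y, z) \in B for
   some y. *)
Definition relprod {X : Type} (A B : set (X * X)) : set (X * X) :=
  (B \; A)%relation.

Record coarse_structure (X : Type) (E : set (set (X * X))) : Prop := {
  coarse_nonempty : forall A, E A -> A !=set0;
  coarse_diagonal : E diagonal;
  coarse_subset : forall A B, E A -> B `<=` A -> B !=set0 -> E B;
  coarse_inverse : forall A, E A -> E (A^-1)%relation;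
  coarse_product : forall A B,
    E A -> E B -> relprod A B !=set0 -> E (relprod A B);
  coarse_union : forall A B, E A -> E B -> E (A `|` B)
}.

Definition coarse_base (X : Type) (E B : set (set (X * X))) : Prop :=
  B `<=` E /\ forall A, E A -> exists2 B0, B B0 & A `<=` B0.

Definition upward_directed (disp : Order.disp_t) (I : porderType disp) : Prop :=
  forall a b : I, exists c : I, a <= c /\ b <= c.

Section CoarseMetric.
Context {X : Type} {disp : Order.disp_t} {I : bPOrderType disp}.
Implicit Type d : X * X -> with_infty I.

Definition entourage_of d (a : I) : set (X * X) := [set p | d p <= Fin a].

Definition mball d (z : X) (a : I) : set X := xsection (entourage_of d a) z.

Definition relative_ball d (x : X) (a : I) (y : X) (b : I) : set X :=
  mball d x a `&` mball d y b.

Record coarse_metric d : Prop := {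
  coarse_metric_refl : forall x, d (x, x) = Fin \bot;
  coarse_metric_sym : forall x y, d (x, y) = d (y, x);
  coarse_metric_prod : exists Phi : I -> I, forall a,
    relprod (entourage_of d a) (entourage_of d a) `<=` entourage_of d (Phi a)
}.

(* A coarse structure is determined by any of its bases, so for a coarse
   structure E this says that E is the one induced by d. *)
Definition metric_defines d (E : set (set (X * X))) : Prop :=
  coarse_base E (range (entourage_of d)).

End CoarseMetric.

(* Every subset of nat_oo has a least upper bound, so the default value of
   [supremum] is only used for the empty set, where 0 is the supremum. *)
Definition sup_natinf (A : set (with_infty nat)) : with_infty nat :=
  supremum (Fin 0%N) A.

Definition cap {X : Type} (E : set (X * X)) (S : set X) : with_infty nat :=
  sup_natinf [set Fin m | m in [set m : nat | exists y : 'I_m -> X,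
    (forall i, S (y i)) /\ (forall i j, i != j -> ~ E (y i, y j))]].

Definition bounded_geometry {X : Type} (EE : set (set (X * X))) : Prop :=
  exists E : set (X * X),
    [/\ EE E, diagonal `<=` E, (E^-1)%relation = E &
      forall F, EE F ->
        sup_natinf (range (fun x : X =>
          Order.max (cap E (xsection (relprod F E) x))
                    (cap E (xsection (relprod (F^-1)%relation E) x))))
        < infty].

(* Main.v *)
Require Import Defs.
From mathcomp Require Import all_boot all_order.
From mathcomp Require Import boolp classical_sets functions cardinality.

Set Implicit Arguments.
Unset Strict Implicit.
Unset Printing Implicit Defensive.

Import Order.TTheory.
Local Open Scope order_scope.
Local Open Scope classical_set_scope.
Local Open Scope card_scope.

(** Capacities, disjoint relative balls and coverings all count points that are
    pairwise far apart, and the scale at which this happens may be enlarged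
    freely, as [Phi] bounds the effect of the triangle inequality.

    The four statements are equivalent because each yields the next, at a scale
    that is the same or enlarged once.  The gauge witnessing bounded geometry
    lies in some [entourage_of d a1]; points that are pairwise farther
    apart than [a1] are then separated for the gauge, so the capacity bound
    limits their number in a ball.  If two relative balls of radius [a1] are
    disjoint, the center of one is not in the other, so disjoint relative balls
    have [a1]-separated centers.  In a maximal family of disjoint relative
    balls of radius [a2], every relative ball meets a member of the family,
    so the balls of radius [Phi a2] at the centers of the members cover the
    ball in which the relative balls are taken.  Finally, two points of a ball of radius [a3] are within
    [Phi a3] of each other, so by the pigeonhole principle a set covered by [n]
    such balls has capacity at most [n] for the gauge [entourage_of d (Phi a3)],
    and every [relprod F E] is inside an entourage of [d].

    The numbers of points occur as capacities, as cardinals of sets and as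
    lengths of finite families; [cap_leP], [card_le_II_family] and
    [card_le_II_cover] translate between them. *)

(** The supremum is specified by [xget]; it has its universal property because
    every set of extended naturals has a least upper bound, by well-foundedness
    of [nat] when a finite upper bound exists. *)
Lemma sup_natinf_leP (A : set (with_infty nat)) (v : with_infty nat) :
  sup_natinf A <= v <-> ubound A v.
Proof.
have [->|A0] := eqVneq A set0.
  rewrite /sup_natinf supremum0; split=> [_ x []//|_].
  by case: v.
have [s sA] : exists s, supremums A s.
  have [bA|nbA] := pselect (exists n, `[< ubound A (Fin n) >]).
    exists (Fin (ex_minn bA)); case: ex_minnP => m /asboolP mA minm.
    split=> // -[n|//] nA.
    by apply: minm; apply/asboolP.
  exists infty; split=> [[]//|[n|//]] nA; exfalso.
  by apply: nbA; exists n; apply/asboolP.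
rewrite /sup_natinf /supremum (negbTE A0).
case: xgetP => [t _ [tA tmin]|/(_ s)//].
split=> [tv x /tA xt|]; first exact: le_trans xt tv.
exact: tmin.
Qed.

Lemma cap_leP (X : Type) (E : set (X * X)) (S : set X) (n : nat) :
  cap E S <= Fin n <->
  forall (m : nat) (y : 'I_m -> X), (forall i, S (y i)) ->
    (forall i j, i != j -> ~ E (y i, y j)) -> (m <= n)%N.
Proof.
rewrite /cap; apply: (iff_trans (sup_natinf_leP _ _)); split.
  move=> ub m y yS ysep; have := ub (Fin m); apply.
  by exists m => //; exists y.
by move=> ub _ [m [y [yS ysep]] <-]; apply: ub yS ysep.
Qed.

Lemma with_infty_nat_ge_max (u v w : with_infty nat) :
  Order.max u v <= w <-> u <= w /\ v <= w.
Proof.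
have uv : (u >=< v)%O.
  by case: u v => [m|] [n|] //; apply: comparableT.
rewrite comparable_ge_max//.
by split=> [/andP[]|[-> ->]].
Qed.

(** Cardinal bounds can be tested on injective finite families: otherwise
    [P] would have at least [n.+1] elements, whether it is finite or not, and
    sections of a surjection onto [`I_n.+1] enumerate that many of them. *)
Lemma card_le_II_family (T : Type) (P : set T) (n : nat) :
  (forall (m : nat) (y : 'I_m -> T), (forall i, P (y i)) -> injective y ->
    (m <= n)%N) -> P #<= `I_n.
Proof.
move=> Pn; apply: contrapT => nP.
have nltP : `I_n.+1 #<= P.
  have [/finite_setP[k Pk]|/infiniteP NP] := pselect (finite_set P).
    rewrite (card_le_eqr Pk) card_le_II ltnNge; apply/negP => kn.
    by apply: nP; rewrite (card_le_eql Pk) card_le_II.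
  by apply: card_le_trans NP; apply: subset_card_le.
have [I0|[f]] := pfcard_geP nltP.
  by have : `I_n.+1 0%N by []; rewrite I0.
have /choice[y yP] : forall i : 'I_n.+1, exists x, P x /\ f x = i.
  move=> i.
  by have [x Px fx] := 'surj_f (ltn_ord i); exists x.
suff : (n.+1 <= n)%N by rewrite ltnn.
apply: (Pn n.+1 y) => [i|i j yij]; first by have [] := yP i.
by apply: ord_inj; have [_ <-] := yP i; have [_ <-] := yP j; rewrite yij.
Qed.

(** The enumeration has length exactly [n]: a surjection from [`I_n] onto [P]
    may repeat values, and [x0] fills it when [P] is empty. *)
Lemma card_le_II_cover (T : Type) (x0 : T) (P : set T) (n : nat) :
  P #<= `I_n -> exists c : 'I_n -> T, P `<=` range c.
Proof.
move=> /pfcard_geP [->|[f]].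
  by exists (fun=> x0).
exists (fun i => f i) => x /(surj (f := f)) [k kn <-].
by exists (Ordinal kn).
Qed.

Section Balls.
Context {X : Type} {disp : Order.disp_t} {I : bPOrderType disp}.
Context {d : X * X -> with_infty I}.

Lemma mballP z a y : mball d z a y <-> d (z, y) <= Fin a.
Proof. exact: xsectionP. Qed.

Hypothesis d_metric : coarse_metric d.

Lemma mball_center z a : mball d z a z.
Proof.
by apply/mballP; rewrite coarse_metric_refl//; exact: le0x.
Qed.

Lemma mball_sym a x y : mball d x a y -> mball d y a x.
Proof. by move=> /mballP xy; apply/mballP; rewrite coarse_metric_sym. Qed.

(** The substitute for the triangle inequality: a common center makes two
    points close at the next scale. *)
Lemma mball_entourage_prod a b :
  relprod (entourage_of d a) (entourage_of d a) `<=` entourage_of d b ->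
  forall c x y, mball d c a x -> mball d c a y -> d (x, y) <= Fin b.
Proof.
move=> Dab c x y /mballP cx /mballP cy; apply: (Dab (x, y)).
by exists c => //=; rewrite /entourage_of/= coarse_metric_sym.
Qed.

End Balls.

Theorem proposition9 (X : Type) (E : set (set (X * X)))
    (disp : Order.disp_t) (I : bPOrderType disp) (d : X * X -> with_infty I)
    (X_nonempty : [set: X] !=set0)
    (E_coarse : coarse_structure E)
    (I_directed : upward_directed I)
    (d_metric : coarse_metric d)
    (d_defines : metric_defines d E) :
  [<-> (* B1 *)
       bounded_geometry E;
       (* B2 *)
       exists a1 : I, forall a : I, exists n1 : nat,
         forall (z : X) (P : set X), P `<=` mball d z a ->
           (forall x y, P x -> P y -> x <> y -> ~ (d (x, y) <= Fin a1)) ->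
           P #<= `I_n1;
       (* B3 *)
       exists a2 : I, forall a : I, exists n2 : nat,
         forall (x : X) (C : set (set X)),
           C `<=` [set relative_ball d x a y a2 | y in mball d x a] ->
           trivIset C id ->
           C #<= `I_n2;
       (* B4 *)
       exists a3 : I, forall a : I, exists n3 : nat,
         forall z : X, exists c : 'I_n3 -> X,
           mball d z a `<=` \bigcup_(i in [set: 'I_n3]) mball d (c i) a3].
Proof.
have [Phi PhiP] := coarse_metric_prod d_metric.
have [DE EsubD] := d_defines.
have ED a : E (entourage_of d a) by apply: DE; exists a.
tfae.
- move=> [G [EG diagG _ capG]].
  have [_ [a1 _ <-] Ga1] := EsubD _ EG.
  exists a1 => a; move: (capG _ (ED a)).
  set s := sup_natinf _; case es: s => [n1|] // _.
  (* A family separated at scale [a1] is separated for the gauge [G]. *)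
  exists n1 => z P Pz Psep; apply: card_le_II_family => m y yP yinj.
  have : s <= Fin n1 by rewrite es.
  move/sup_natinf_leP => /(_ _ (ex_intro2 _ _ z Logic.I erefl)).
  rewrite with_infty_nat_ge_max => -[/cap_leP capz _].
  apply: (capz m y) => [i|i j ij /Ga1 dij].
    apply/xsectionP; exists (y i); last exact: diagG.
    exact/mballP/Pz/yP.
  apply: Psep dij => //.
  by move=> /yinj /eqP; apply/negP.
- move=> [a1 B2]; exists a1 => a; have [n1 {}B2] := B2 a.
  exists n1 => x C Cball Cdisj.
  have /choice[c cP] : forall S, exists y, C S ->
      mball d x a y /\ relative_ball d x a y a1 = S.
    move=> S; have [CS|nCS] := pselect (C S); last by exists x.
    by have [y xy yS] := Cball S CS; exists y.
  have cinj : {in C &, injective c}.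
    move=> S S' /set_mem/cP[_ Sball] /set_mem/cP[_ S'ball] cc.
    by rewrite -[LHS]Sball -[RHS]S'ball cc.
  (* [C] is counted through the centers of its members, to which the bound on
     separated points applies. *)
  rewrite -(card_le_eql (inj_card_eq cinj)); apply: (B2 x).
    by move=> _ [S /cP[xS _] <-].
  (* If two centers are within [a1], then [c S'] lies in both [S] and [S']. *)
  move=> _ _ [S CS <-] [S' CS' <-] cSS' cc; apply: cSS'; congr c.
  have [xS Sball] := cP _ CS; have [xS' Sball'] := cP _ CS'.
  apply: Cdisj => //; exists (c S'); split.
    by rewrite /= -[S]Sball; split=> //; apply/mballP.
  by rewrite /= -[S' in X in X _]Sball'; split=> //; apply: mball_center.
- move=> [a2 B3]; exists (Phi a2) => a; have [n2 {}B3] := B3 a.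
  exists n2 => z.
  pose rball y := relative_ball d z a y a2.
  have [P [Pz Pdisj Pmax]] :=
    ex_maximal_disjoint_subcollection rball (mball d z a).
  have rballE y : mball d z a y -> rball y y.
    by move=> zy; split=> //; apply: mball_center.
  (* Relative balls are non-empty, so disjoint ones have distinct centers; hence
     [P] has as many elements as there are balls in the family. *)
  have rinj : {in P &, injective rball}.
    move=> y y' /set_mem Py /set_mem Py' yy'; apply: Pdisj => //.
    by exists y; split; rewrite -?yy'; apply: rballE; apply: Pz.
  have [c Pc] : exists c : 'I_n2 -> X, P `<=` range c.
    apply: (card_le_II_cover z); rewrite -(card_le_eql (inj_card_eq rinj)).
    apply: (B3 z) => [_ [y Py <-]|]; first by exists y => //; apply: Pz.
    move=> _ _ [y Py <-] [y' Py' <-] yy'; congr rball; exact: Pdisj.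
  exists c => y zy.
  (* A common point [w] of the relative balls at [p] and [y] makes [y] lie in
     the ball of radius [Phi a2] at [p]. *)
  suff [p Pp [w [[_ pw] [_ yw]]]] : exists2 p, P p & rball p `&` rball y !=set0.
    have [i _ cip] := Pc p Pp.
    exists i => //; rewrite cip; apply/mballP.
    by apply: (mball_entourage_prod d_metric (PhiP a2) (c := w));
      apply: mball_sym.
  apply: contrapT => nmeet.
  have nPy : ~ P y.
    by move=> Py; apply: nmeet; exists y => //; exists y; split; apply: rballE.
  (* Otherwise the relative ball at [y] could be added to the family. *)
  apply: (Pmax (y |` P)).
  + by split=> [t Pt|/(_ y (or_introl erefl))//]; right.
  + by move=> t [->//|/Pz].
  + move=> t t' [->|Pt] [->|Pt'] // tt'.
    * by exfalso; apply: nmeet; exists t' => //; rewrite setIC.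
    * by exfalso; apply: nmeet; exists t.
    * exact: Pdisj.
- move=> [a3 B4]; exists (entourage_of d (Phi a3)).
  have dD b : diagonal `<=` entourage_of d b.
    by move=> [x y] /= /diagonalP <-; apply/mballP/mball_center.
  have DP := mball_entourage_prod d_metric (PhiP a3).
  split=> //.
    by apply/seteqP; split=> -[x y]; rewrite /entourage_of/= coarse_metric_sym.
  move=> F EF; set G := entourage_of d (Phi a3).
  have EG H : E H -> E (relprod H G).
    move=> EH; apply: (coarse_product E_coarse EH (ED _)).
    have [[x y] Hxy] := coarse_nonempty E_coarse EH.
    by exists (x, y); exists y => //; apply: dD.
  (* Taking the union yields one radius [b] for both products. *)
  have [_ [b _ <-] FGb] := EsubD _
    (coarse_union E_coarse (EG _ EF) (EG _ (coarse_inverse E_coarse EF))).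
  have [n3 {}B4] := B4 b.
  suff : sup_natinf (range (fun x : X =>
      Order.max (cap G (xsection (relprod F G) x))
                (cap G (xsection (relprod (F^-1)%relation G) x)))) <= Fin n3.
    by move: (sup_natinf _) => [].
  apply/sup_natinf_leP => _ [x _ <-]; rewrite with_infty_nat_ge_max.
  have [c cover] := B4 x.
  have capb (S : set X) : S `<=` mball d x b -> cap G S <= Fin n3.
    move=> Sb; apply/cap_leP => m y yS ysep.
    (* Separated points must be in different balls of the covering. *)
    have /choice[k ky] : forall i, exists k, mball d (c k) a3 (y i).
      by move=> i; have [k _ kyi] := cover _ (Sb _ (yS i)); exists k.
    suff /leq_card : injective k by rewrite !card_ord.
    move=> i j kij; apply/eqP; apply: contrapT => /negP/ysep; apply.
    by apply: DP (ky i) _; rewrite kij.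
  by split; apply: capb => y /xsectionP Fxy; apply/mballP; apply: (FGb (x, y));
    [left|right].
Qed.
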